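(* Let $(S,\mathcal{U})$ be a composable map of rank $k$, let $q_{\min}>0$ and $\delta\in(0,1)$. Then there is $L\subseteq\mathcal{U}$ of size $|L|=O(k^2\log(k/\delta)/q_{\min})$ such that $$\forall q\ge q_{\min},\ \forall M\subseteq\mathcal{U}:\quad \Pr_{U\sim\mathrm{Bern}[q]^{\mathcal{U}}}\big[S((U\cap L)\cup M)=S(U\cup M)\big]\ge1-\delta.$$ If in addition $(S,\mathcal{U})$ is monotone, then there is such an $L$ of size $|L|=O(k\log(k/\delta)/q_{\min})$.
   Context: $(S,\mathcal{U})$: finite ground set $\mathcal{U}$ and map $S:2^{\mathcal{U}}\to\Sigma$. Composable: there is a binary operation $\oplus$ on $\Sigma$ with $S(U\cup V)=S(U)\oplus S(V)$ for all $U,V$. A core of a sketch $\sigma$ is a minimal (under inclusion) set $U$ with $S(U)=\sigma$. The rank is the maximum size of a core of any sketch in $S(2^{\mathcal{U}})$. Monotone: for all $A',U_1,U_2\subseteq\mathcal{U}$ with $U_1\subseteq U_2$, if $C_i\subseteq U_i$ ($i=1,2$) is minimal such that $S(C_i\cup A')=S(U_i\cup A')$, then $|C_1|\le|C_2|$. $\mathrm{Bern}[q]^{\mathcal{U}}$ includes each element of $\mathcal{U}$ independently with probability $q$.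
   Formalization: The size bounds on L are read as rounded up to the next integer, with one absolute constant; without rounding the claim fails for k = 1 and δ near 1 (one-point ground set, S(U) = [U nonempty], q = 1 needs |L| ≥ 1 while log(1/δ) tends to 0). *)

(* Defs.v *)
From mathcomp Require Import all_boot all_order all_algebra.
From mathcomp Require Import boolp reals exp.
Set Implicit Arguments.
Unset Strict Implicit.
Unset Printing Implicit Defensive.
Import Order.TTheory GRing.Theory Num.Theory.
Local Open Scope ring_scope.

(* A sketching map is [S : {set T} -> Sigma]: the ground set is the whole
   finite type [T]. *)

Definition composable (T : finType) (Sigma : Type) (S : {set T} -> Sigma) :
    Prop :=
  exists op : Sigma -> Sigma -> Sigma,
    forall U V : {set T}, S (U :|: V) = op (S U) (S V).

(* [minset p U]: [U] is inclusion-minimal among the sets satisfying [p]. *)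
Definition core (T : finType) (Sigma : Type) (S : {set T} -> Sigma)
    (sigma : Sigma) (U : {set T}) : bool :=
  minset (fun V : {set T} => `[< S V = sigma >]) U.

Definition rank (T : finType) (Sigma : Type) (S : {set T} -> Sigma) : nat :=
  \max_(U : {set T} | [exists W : {set T}, core S (S W) U]) #|U|.

Definition monotone (T : finType) (Sigma : Type) (S : {set T} -> Sigma) :
    Prop :=
  forall A U1 U2 C1 C2 : {set T},
    U1 \subset U2 ->
    C1 \subset U1 ->
    minset (fun C : {set T} => `[< S (C :|: A) = S (U1 :|: A) >]) C1 ->
    C2 \subset U2 ->
    minset (fun C : {set T} => `[< S (C :|: A) = S (U2 :|: A) >]) C2 ->
    (#|C1| <= #|C2|)%N.

(* Probability mass at [U] of the random subset of [T] that contains each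
   element independently with probability [q]; meant for [0 <= q <= 1]. *)
Definition bern (R : realType) (T : finType) (q : R) (U : {set T}) : R :=
  \prod_(x : T) (if x \in U then q else 1 - q).

Definition Pr_bern (R : realType) (T : finType) (q : R)
    (E : {set T} -> Prop) : R :=
  \sum_(U : {set T} | `[< E U >]) bern q U.

(* Main.v *)
Require Import Defs.
From mathcomp Require Import all_boot all_order all_algebra.
From mathcomp Require Import boolp reals sequences exp.
From mathcomp Require Import ring lra.
Import Order.TTheory GRing.Theory Num.Theory.
Local Open Scope ring_scope.

(* Peel [r] layers off the ground set: a core of everything, a core of what is
   left, and so on. A layer spans whatever is left below it, so [U :&: L] fails
   only if each layer has a point outside the closure of
   [(U :&: L) :|: M].
   In the monotone case, look at a smallest subset of what is left that,
   together with the sample from the layers seen so far, spans the rest: it may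
   be taken inside the next layer, and by monotonicity its expected size drops
   by a factor [1 - q] at each layer. Markov's inequality concludes.
   In general, the closure of the sample is generated over [M] by at most [k]
   sampled points [K], and at least [r] peeled points outside that closure are
   unsampled. A union bound over [K] costs [\sum_K q^|K|], which is at most
   [(2 k)^k expR (r q / 2)], against a gain of [(1 - q)^r]. *)

(** * Spanning and closure relative to a context *)

(** Boolean, so that [minset (spans S A W)] is, up to conversion, the minimality condition in
    [monotone]. *)
Definition spans {T : finType} {Sigma : Type} (S : {set T} -> Sigma)
    (A W V : {set T}) : bool :=
  `[< S (V :|: A) = S (W :|: A) >].

Definition redundant {T : finType} {Sigma : Type} (S : {set T} -> Sigma)
    (A X : {set T}) : Prop :=
  S (X :|: A) = S A.

Lemma composable_cong {T : finType} {Sigma : Type} {S : {set T} -> Sigma}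
    (hS : composable S) (U V W : {set T}) :
  S U = S V -> S (U :|: W) = S (V :|: W).
Proof. by case: hS => op hop e; rewrite !hop e. Qed.

Lemma spans_sandwich {T : finType} {Sigma : Type} {S : {set T} -> Sigma}
    (hS : composable S) (A W V X B : {set T}) :
  spans S A W V -> V :|: A \subset X :|: B -> X \subset W -> A \subset B ->
  spans S B W X.
Proof.
move=> /asboolP e VX XW AB; apply/asboolP.
have := composable_cong hS _ _ (X :|: B) e.
rewrite (setUidPr VX) => ->; congr S.
by rewrite setUACA (setUidPl XW) (setUidPr AB).
Qed.

Lemma redundantS {T : finType} {Sigma : Type} {S : {set T} -> Sigma}
    (hS : composable S) (A X Y : {set T}) :
  X \subset Y -> redundant S A Y -> redundant S A X.
Proof.
move=> XY eY; have := composable_cong hS _ _ X eY.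
by rewrite setUAC (setUidPl XY) eY setUC.
Qed.

(** Redundancy is stable under unions, so the closure of [A] can be treated as a set of points. *)
Lemma redundant1 {T : finType} {Sigma : Type} {S : {set T} -> Sigma}
    (hS : composable S) (A X : {set T}) :
  (forall x, x \in X -> redundant S A [set x]) -> redundant S A X.
Proof.
move=> h; have -> : X = \bigcup_(x in X) [set x].
  apply/setP=> y; apply/idP/bigcupP => [yX|[x xX /set1P -> //]].
  by exists y => //; apply/set1P.
apply: (big_ind (fun Y => redundant S A Y)) => [|Y Z hY hZ|//].
  by rewrite /redundant set0U.
by rewrite /redundant -setUA setUC (composable_cong hS _ _ Y hZ) setUC.
Qed.

(** [rank] only sees cores without a context. But a subset of [C] with the sketch of [C] would span
    [W] over [A] as well, so minimality makes [C] a core of [S C]. *)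
Lemma spans_card_le_rank {T : finType} {Sigma : Type} {S : {set T} -> Sigma}
    (hS : composable S) (A W C : {set T}) :
  minset (spans S A W) C -> (#|C| <= rank S)%N.
Proof.
move=> /minsetP[/asboolP eC minC].
have hC : `[< S C = S C >] by apply/asboolP.
have [C0 mC0 C0C] := minset_exists (P := fun V => `[< S V = S C >]) hC.
have /minsetP[/asboolP eC0 _] := mC0.
have <- : C0 = C.
  by apply: minC => //; apply/asboolP; rewrite (composable_cong hS _ _ A eC0).
apply: (@leq_bigmax_cond _ _ (fun U : {set T} => #|U|)).
by apply/existsP; exists C.
Qed.

Lemma exists_minimal_span {T : finType} {Sigma : Type} (S : {set T} -> Sigma)
    (A W V : {set T}) :
  spans S A W V -> {C : {set T} | minset (spans S A W) C & C \subset V}.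
Proof. exact: minset_exists. Qed.

Lemma spans_refl {T : finType} {Sigma : Type} (S : {set T} -> Sigma)
    (A W : {set T}) : spans S A W W.
Proof. exact/asboolP. Qed.

(** * Peeling off layers *)

Definition basis {T : finType} {Sigma : Type} (S : {set T} -> Sigma)
    (W : {set T}) : {set T} :=
  s2val (exists_minimal_span S set0 W W (spans_refl S set0 W)).

Lemma basis_sub {T : finType} {Sigma : Type} (S : {set T} -> Sigma)
    (W : {set T}) : basis S W \subset W.
Proof. exact: (s2valP' (exists_minimal_span _ _ _ _ _)). Qed.

Lemma card_basis_le {T : finType} {Sigma : Type} {S : {set T} -> Sigma}
    (hS : composable S) (W : {set T}) : (#|basis S W| <= rank S)%N.
Proof.
apply: (spans_card_le_rank hS set0 W).
exact: (s2valP (exists_minimal_span _ _ _ _ _)).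
Qed.

(** The basis is chosen over the empty context, and composability carries its spanning over to every
    [A]. This is why one peeled set serves all [M]. *)
Lemma basis_spans {T : finType} {Sigma : Type} {S : {set T} -> Sigma}
    (hS : composable S) (A W : {set T}) : spans S A W (basis S W).
Proof.
have /minsetP[/asboolP e _] :=
  s2valP (exists_minimal_span S set0 W W (spans_refl S set0 W)).
apply/asboolP; apply: (composable_cong hS); by rewrite !setU0 in e.
Qed.

Fixpoint peel {T : finType} {Sigma : Type} (S : {set T} -> Sigma)
    (r : nat) (W : {set T}) : {set T} :=
  if r is r'.+1 then basis S W :|: peel S r' (W :\: basis S W) else set0.

Lemma peel_sub {T : finType} {Sigma : Type} (S : {set T} -> Sigma)
    (r : nat) (W : {set T}) : peel S r W \subset W.
Proof.
elim: r W => [|r IH] W /=; first exact: sub0set.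
by rewrite subUset basis_sub (subset_trans (IH _)) // subsetDl.
Qed.

Lemma card_peel_le {T : finType} {Sigma : Type} {S : {set T} -> Sigma}
    (hS : composable S) (r : nat) (W : {set T}) :
  (#|peel S r W| <= r * rank S)%N.
Proof.
elim: r W => [|r IH] W /=; first by rewrite cards0.
apply: leq_trans (leq_card_setU _ _) _.
by rewrite mulSn leq_add // card_basis_le.
Qed.

(* Each of the [r] disjoint layers spans [W :\: peel S r W], so it contains an
   element outside the closure of [A]. *)
Lemma peel_escape {T : finType} {Sigma : Type} {S : {set T} -> Sigma}
    (hS : composable S) (r : nat) (A W : {set T}) :
  ~ redundant S A (W :\: peel S r W) ->
  (r <= #|[set x in peel S r W | ~~ `[< redundant S A [set x] >]]|)%N.
Proof.
elim: r W => [//|r IH] W /=; set B := basis S W; set W' := W :\: B => nred.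
have nredB : ~ redundant S A B.
  move=> rB; apply: nred; apply: (redundantS hS _ _ W); first exact: subsetDl.
  by have /asboolP e := basis_spans hS A W; rewrite /redundant -e.
have [b bB nb] : exists2 b, b \in B & ~ redundant S A [set b].
  apply: contrapT => h; apply: nredB; apply: (redundant1 hS) => x xB.
  by apply: contrapT => nx; apply: h; exists x.
have := IH W'; rewrite /W' setDDl => /(_ nred) le.
set X := [set x in peel S r W' | _] in le.
(* The later layers are taken from [W :\: B], so [b] is a new point. *)
have bX : b \notin X.
  rewrite inE negb_and; apply/orP; left; apply/negP.
  by move=> /(subsetP (peel_sub _ _ _)); rewrite inE bB.
apply: leq_ltn_trans le _; apply: (@leq_trans #|b |: X|).
  by rewrite cardsU1 bX.
apply/subset_leq_card/subsetP => x; rewrite !inE => /orP[/eqP -> | /andP[-> ->]].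
  by rewrite bB; apply/asboolPn.
by rewrite orbT.
Qed.

(** * Sums over Bernoulli random sets *)

Lemma bern_ge0 {R : realType} {T : finType} (q : R) (U : {set T}) :
  0 <= q -> q <= 1 -> 0 <= bern q U.
Proof. by move=> q0 q1; apply: prodr_ge0 => x _; case: ifP; rewrite ?subr_ge0. Qed.

Lemma sum_set_prod {R : realType} {T : finType} (F G : T -> R) :
  \sum_(U : {set T}) \prod_x (if x \in U then F x else G x) =
  \prod_x (F x + G x).
Proof. by rewrite bigA_distr. Qed.

Lemma sum_bern {R : realType} {T : finType} (q : R) :
  \sum_(U : {set T}) bern q U = 1.
Proof. by rewrite sum_set_prod big1 // => x _; rewrite addrC subrK. Qed.

Lemma sum_bern_cylinder {R : realType} {T : finType} (q : R) (K D : {set T}) :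
  [disjoint K & D] ->
  \sum_(U : {set T} | (K \subset U) && [disjoint U & D]) bern q U =
  q ^+ #|K| * (1 - q) ^+ #|D|.
Proof.
move=> KD.
(* The constraints are encoded as zero weights: a set that meets [D] or omits a point of [K]
   contributes a zero factor. *)
pose F x : R := if x \in D then 0 else q.
pose G x : R := if x \in K then 0 else 1 - q.
transitivity (\sum_(U : {set T}) \prod_x (if x \in U then F x else G x)).
  rewrite big_mkcond; apply: eq_bigr => U _; case: ifPn => [/andP[KU UD]|].
    apply: eq_bigr => x _; rewrite /F /G; case: ifPn => xU.
      by rewrite (disjointFr UD xU).
    by rewrite (contraNF (subsetP KU x) xU).
  rewrite negb_and => /orP[/subsetPn[x xK xU]|].
    by rewrite (bigD1 x) //= (negbTE xU) /G xK mul0r.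
  rewrite -setI_eq0 => /set0Pn[x /setIP[xU xD]].
  by rewrite (bigD1 x) //= xU /F xD mul0r.
rewrite sum_set_prod -!prodr_const (big_mkcond (mem K)) (big_mkcond (mem D)).
rewrite -big_split; apply: eq_bigr => x _; rewrite /F /G /=.
case: ifPn => xD; last by case: ifP; rewrite ?mulr1 ?mul1r ?addr0 // addrC subrK.
by rewrite (disjointFl KD xD) add0r mul1r.
Qed.

Lemma sum_bern_notin {R : realType} {T : finType} (q : R) (x : T) :
  \sum_(U : {set T} | x \notin U) bern q U = 1 - q.
Proof.
have := @sum_bern_cylinder R T q set0 [set x].
rewrite cards0 cards1 mul1r expr1 => <-; last by rewrite -setI_eq0 set0I.
by apply: eq_bigl => U; rewrite sub0set disjoint_sym disjoints1.
Qed.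

(** Linearity of expectation over the points of [C]. *)
Lemma sum_bern_cardD {R : realType} {T : finType} (q : R) (C : {set T}) :
  \sum_(U : {set T}) bern q U * #|C :\: U|%:R = #|C|%:R * (1 - q).
Proof.
transitivity (\sum_(U : {set T}) \sum_(x in C) (if x \notin U then bern q U else 0)).
  apply: eq_bigr => U _; rewrite -big_mkcondr /= mulr_natr -sumr_const.
  by apply: eq_bigl => x; rewrite inE andbC.
rewrite exchange_big /= mulr_natl -sumr_const; apply: eq_bigr => x _.
by rewrite -big_mkcond sum_bern_notin.
Qed.

Definition splice {T : finType} (B X Y : {set T}) : {set T} :=
  (X :&: B) :|: (Y :\: B).

(* Resampling the elements outside [B] does not change the law: exchanging the
   parts of [X] and [Y] outside [B] is a weight-preserving involution. *)
Lemma sum_bern_splice {R : realType} {T : finType} (q : R) (B : {set T})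
    (f : {set T} -> R) :
  \sum_(X : {set T}) bern q X * \sum_(Y : {set T}) bern q Y * f (splice B X Y) =
  \sum_(U : {set T}) bern q U * f U.
Proof.
pose h (p : {set T} * {set T}) := (splice B p.1 p.2, splice B p.2 p.1).
have hK : involutive h.
  case=> X Y; rewrite /h /splice /=; congr pair; apply/setP => x; rewrite !inE;
  by case: (x \in B); case: (x \in X); case: (x \in Y).
have bh X Y : bern q X * bern q Y =
              bern q (splice B X Y) * bern q (splice B Y X).
  rewrite /bern -!big_split; apply: eq_bigr => x _; rewrite /splice /= !inE.
  case: (x \in B); rewrite ?andbT ?andbF ?orbF //=; exact: mulrC.
transitivity (\sum_(p : {set T} * {set T})
    (bern q p.1 * f p.1) * bern q p.2); last first.
  rewrite -(pair_bigA _ (fun X Y => bern q X * f X * bern q Y)) /=.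
  by apply: eq_bigr => X _; rewrite -big_distrr /= sum_bern mulr1.
rewrite (reindex_inj (inv_inj hK)) /=.
rewrite -(pair_bigA _ (fun X Y => bern q (splice B X Y) * f (splice B X Y)
                                 * bern q (splice B Y X))) /=.
apply: eq_bigr => X _; rewrite big_distrr; apply: eq_bigr => Y _ /=.
by rewrite mulrA bh mulrAC.
Qed.

Lemma sum_subsets_expr {R : realType} {T : finType} (z : R) (L : {set T}) :
  \sum_(K : {set T} | K \subset L) z ^+ #|K| = (1 + z) ^+ #|L|.
Proof.
pose F x : R := if x \in L then z else 0.
transitivity (\sum_(K : {set T}) \prod_x (if x \in K then F x else 1)).
  rewrite big_mkcond; apply: eq_bigr => K _; case: ifPn => [KL|].
    rewrite -prodr_const big_mkcond; apply: eq_bigr => x _.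
    by case: ifP => // /(subsetP KL) xL; rewrite /F xL.
  move=> /subsetPn[x xK xL].
  by rewrite (bigD1 x) //= xK /F (negbTE xL) mul0r.
rewrite sum_set_prod -prodr_const [RHS]big_mkcond; apply: eq_bigr => x _.
by rewrite /F; case: ifP => _; rewrite ?add0r // addrC.
Qed.

Lemma Pr_bernE {R : realType} {T : finType} (q : R) (E : {set T} -> Prop) :
  Pr_bern q E = \sum_(U : {set T}) bern q U * (`[< E U >])%:R.
Proof.
rewrite /Pr_bern big_mkcond; apply: eq_bigr => U _.
by case: ifP => _; rewrite ?mulr1 ?mulr0.
Qed.

Lemma Pr_bern_ge {R : realType} {T : finType} (q d : R) (E : {set T} -> Prop) :
  Pr_bern q (fun U => ~ E U) <= d -> 1 - d <= Pr_bern q E.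
Proof.
move=> h; rewrite lerBlDr -(@sum_bern R T q).
rewrite (bigID (fun U => `[< E U >])) /= lerD2l.
apply: le_trans h; rewrite /Pr_bern le_eqVlt; apply/orP; left; apply/eqP.
by apply: eq_bigl => U; rewrite asbool_neg.
Qed.

(** * The monotone case: decay of the expected spanning size *)

Lemma monotone_card_le {T : finType} {Sigma : Type} {S : {set T} -> Sigma}
    (hM : monotone S) (A U1 U2 C1 C2 : {set T}) :
  U1 \subset U2 -> C1 \subset U1 -> minset (spans S A U1) C1 ->
  C2 \subset U2 -> minset (spans S A U2) C2 -> (#|C1| <= #|C2|)%N.
Proof. exact: hM. Qed.

(** Cut [V] and [C] down to minimal spanning sets of [W'] and [W]; monotonicity compares their
    sizes. *)
Lemma monotone_span_exchange {T : finType} {Sigma : Type}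
    {S : {set T} -> Sigma} (hS : composable S) (hM : monotone S)
    (A W W' V C : {set T}) :
  W' \subset W -> V \subset W' -> spans S A W' V ->
  C \subset W -> spans S A W C ->
  exists2 D : {set T}, D \subset V /\ spans S A W' D & (#|D| <= #|C|)%N.
Proof.
move=> W'W VW' sV CW sC.
have [D mD DV] := exists_minimal_span _ _ _ _ sV.
have [E mE EC] := exists_minimal_span _ _ _ _ sC.
exists D; first by split=> //; have /minsetP[] := mD.
apply: leq_trans (subset_leq_card EC).
apply: (monotone_card_le hM A W' W) => //.
  exact: subset_trans DV VW'.
exact: subset_trans EC CW.
Qed.

Definition misses {T : finType} {Sigma : Type} (S : {set T} -> Sigma)
    (r : nat) (A W U : {set T}) : Prop :=
  ~ redundant S ((U :&: peel S r W) :|: A) (W :\: peel S r W).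

(** Conditioning on the first layer: [X] decides the sample on [B], which joins the context, and [Y]
    decides everything below. *)
Lemma misses_peelS {T : finType} {Sigma : Type} (S : {set T} -> Sigma)
    (r : nat) (A W X Y : {set T}) :
  let B := basis S W in
  misses S r.+1 A W (splice B X Y) =
  misses S r ((X :&: B) :|: A) (W :\: B) Y.
Proof.
move=> B; rewrite /misses /= -/B setDDl; congr (~ redundant S _ _).
have /subsetP sub := peel_sub S r (W :\: B).
apply/setP => x; rewrite /splice !inE.
have := sub x; rewrite inE.
case: (x \in peel _ _ _) => [/(_ isT)/andP[/negbTE -> _]|_].
  by rewrite !andbF !andbT.
by case: (x \in B); rewrite ?andbT ?andbF ?orbF.
Qed.

Lemma sum_misses_le {R : realType} {T : finType} {Sigma : Type}
    {S : {set T} -> Sigma} (hS : composable S) (hM : monotone S) (q : R)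
    (r : nat) (A W C : {set T}) :
  0 <= q -> q <= 1 -> C \subset W -> spans S A W C ->
  Pr_bern q (misses S r A W) <= #|C|%:R * (1 - q) ^+ r.
Proof.
move=> q0 q1; rewrite Pr_bernE.
elim: r A W C => [|r IH] A W C CW sC.
  rewrite expr0 mulr1.
  (* With no layer the bound is at least 1 unless [C] is empty, and then [W] is already redundant
     over [A]. *)
  have [C0|Cn] := eqVneq C set0.
    rewrite big1 ?cards0 ?ler0n // => U _; case: asboolP => [|_]; last by rewrite mulr0.
    rewrite /misses /= setI0 setD0 set0U => -[].
    by move/asboolP: sC; rewrite C0 set0U /redundant => ->.
  apply: (@le_trans _ _ 1); last by rewrite ler1n card_gt0.
  rewrite -[leRHS](@sum_bern R T q); apply: ler_sum => U _.
  by case: `[< _ >]; rewrite ?mulr1 ?mulr0 ?bern_ge0.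
set B := basis S W.
have [D [DB sD] leDC] := monotone_span_exchange hS hM A W W B C (subxx W)
  (basis_sub S W) (basis_spans hS A W) CW sC.
rewrite -(sum_bern_splice q B).
(* Given [X], the set [D :\: X] of unsampled points is still enough; its mean size [#|D| * (1 - q)]
   supplies the extra factor. *)
apply: (@le_trans _ _ (\sum_(X : {set T})
    bern q X * (#|D :\: X|%:R * (1 - q) ^+ r))); last first.
  under eq_bigr do rewrite mulrA.
  rewrite -big_distrl /= sum_bern_cardD -mulrA -exprS.
  by rewrite ler_wpM2r ?exprn_ge0 ?subr_ge0 // ler_nat.
apply: ler_sum => X _; rewrite ler_wpM2l ?bern_ge0 //.
under eq_bigr do rewrite misses_peelS.
set A' := (X :&: B) :|: A.
have DW : D \subset W := subset_trans DB (basis_sub S W).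
have sDX : spans S A' W (D :\: X).
  apply: (spans_sandwich hS) sD _ _ _.
  - apply/subsetP => x; rewrite !inE => /orP[xD|->]; last by rewrite !orbT.
    by rewrite xD (subsetP DB x xD); case: (x \in X).
  - exact: subset_trans (subsetDl _ _) DW.
  - exact: subsetUr.
(* Monotonicity replaces [D :\: X], which lies in the removed layer, by a set inside [W :\: B] that
   is no larger. *)
have [D' [D'W sD'] leD'] := monotone_span_exchange hS hM A' W (W :\: B)
  (W :\: B) (D :\: X) (subsetDl _ _) (subxx _) (spans_refl _ _ _)
  (subset_trans (subsetDl _ _) DW) sDX.
apply: le_trans (IH A' (W :\: B) D' D'W sD') _.
by rewrite ler_wpM2r ?exprn_ge0 ?subr_ge0 // ler_nat.
Qed.

(** * From redundancy of the unpeeled points to equality of sketches *)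

Lemma redundant_restrict {T : finType} {Sigma : Type} {S : {set T} -> Sigma}
    (hS : composable S) (L M U : {set T}) :
  redundant S ((U :&: L) :|: M) (setT :\: L) ->
  S ((U :&: L) :|: M) = S (U :|: M).
Proof.
move=> /(redundantS hS _ (U :\: L)); rewrite setTD setDE subsetIr => /(_ isT) <-.
by rewrite setUA -setIUr (setUC (~: L)) setUCr setIT.
Qed.

Lemma Pr_bern_mono {R : realType} {T : finType} (q : R)
    (E F : {set T} -> Prop) :
  0 <= q -> q <= 1 -> (forall U, E U -> F U) -> Pr_bern q E <= Pr_bern q F.
Proof.
move=> q0 q1 EF; rewrite !Pr_bernE; apply: ler_sum => U _.
rewrite ler_wpM2l ?bern_ge0 // ler_nat.
by case: asboolP => [/EF|] // FU; rewrite asboolT.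
Qed.

Lemma Pr_sketch_ge {R : realType} {T : finType} {Sigma : Type}
    {S : {set T} -> Sigma} (hS : composable S) (q d : R) (r : nat)
    (M : {set T}) :
  0 <= q -> q <= 1 -> Pr_bern q (misses S r M setT) <= d ->
  1 - d <= Pr_bern q (fun U => S ((U :&: peel S r setT) :|: M) = S (U :|: M)).
Proof.
move=> q0 q1 h; apply: Pr_bern_ge; apply: le_trans h.
by apply: Pr_bern_mono => // U nE rU; apply: nE; apply: (redundant_restrict hS).
Qed.

(** * The general case: small rank and the union bound *)

Lemma rank_le1_monotone {T : finType} {Sigma : Type} {S : {set T} -> Sigma}
    (hS : composable S) : (rank S <= 1)%N -> monotone S.
Proof.
move=> k1 A U1 U2 C1 C2 U12 C1U mC1 C2U mC2.
have := leq_trans (spans_card_le_rank hS _ _ _ mC1) k1.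
have [C20|] := eqVneq C2 set0; last first.
  by rewrite -card_gt0 => lt le; apply: leq_trans le lt.
(* An empty [C2] makes [U2], hence [U1], redundant over [A]; minimality then empties [C1]. *)
have /minsetP[/asboolP] := mC2; rewrite C20 set0U => e _ _.
have /minsetP[_ /(_ set0) minC1] := mC1.
rewrite -minC1 ?sub0set //; apply/asboolP; rewrite set0U.
exact/esym/(redundantS hS A U1 U2 U12 (esym e)).
Qed.

(* The factor [lambda ^+ rank S] replaces the weight [q ^+ #|K|] by
   [(q / lambda) ^+ #|K|], which sums to a binomial over all [K \subset L]. *)
Lemma Pr_misses_le {R : realType} {T : finType} {Sigma : Type}
    {S : {set T} -> Sigma} (hS : composable S) (q lambda : R) (r : nat)
    (M W : {set T}) :
  0 <= q -> q <= 1 -> 1 <= lambda ->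
  Pr_bern q (misses S r M W) <=
  lambda ^+ rank S * (1 + q / lambda) ^+ (r * rank S) * (1 - q) ^+ r.
Proof.
move=> q0 q1 l1; set L := peel S r W; set k := rank S.
have l0 : 0 < lambda by exact: lt_le_trans l1.
have l0' := ltW l0.
pose D (K : {set T}) := [set x in L | ~~ `[< redundant S (K :|: M) [set x] >]].
pose P (K : {set T}) := [&& K \subset L, #|K| <= k & r <= #|D K|]%N.
pose Q (K U : {set T}) := (K \subset U) && [disjoint U & D K].
(* [K] is a minimal part of the sample in [L] with the same closure over [M]. [D K] collects the
   peeled points outside that closure: none is sampled, and [peel_escape] gives at least [r] of
   them. *)
have cover U : misses S r M W U -> exists2 K, P K & Q K U.
  move=> mU.
  have [K mK KU] := exists_minimal_span S M (U :&: L) _ (spans_refl _ _ _).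
  have /minsetP[/asboolP eK _] := mK.
  have KL : K \subset L := subset_trans KU (subsetIr _ _).
  have red x : redundant S (K :|: M) [set x] <->
               redundant S ((U :&: L) :|: M) [set x].
    rewrite /redundant eK !(setUC [set x]).
    by rewrite (composable_cong hS _ _ [set x] eK).
  have DE : D K = [set x in L | ~~ `[< redundant S ((U :&: L) :|: M) [set x] >]].
    by apply/setP => x; rewrite !inE (asbool_equiv_eq (red x)).
  exists K.
    rewrite /P KL (spans_card_le_rank hS _ _ _ mK) DE /=.
    exact: (peel_escape hS) mU.
  rewrite /Q (subset_trans KU (subsetIl _ _)) /= DE -setI_eq0.
  apply/eqP/setP => x; rewrite !inE; apply/negP => /and3P[xU xL /asboolP[]].
  congr S; apply/setUidPr; rewrite sub1set !inE xU xL //.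
have step1 : Pr_bern q (misses S r M W) <=
    \sum_(K | P K) \sum_(U : {set T} | Q K U) bern q U.
  rewrite Pr_bernE; under [leRHS]eq_bigr do rewrite big_mkcond.
  rewrite exchange_big /=; apply: ler_sum => U _.
  case: asboolP => [/cover[K PK QK]|_]; last first.
    by rewrite mulr0; apply: sumr_ge0 => K _; case: ifP => // _; rewrite bern_ge0.
  rewrite mulr1 (bigD1 K) //= QK lerDl.
  by apply: sumr_ge0 => K' _; case: ifP => // _; rewrite bern_ge0.
apply: le_trans step1 _.
have z0 : 0 <= q / lambda by rewrite divr_ge0.
apply: (@le_trans _ _ (\sum_(K : {set T} | K \subset L)
   lambda ^+ k * (q / lambda) ^+ #|K| * (1 - q) ^+ r)); last first.
  rewrite -big_distrl -big_distrr /= sum_subsets_expr.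
  apply: ler_wpM2r; first by rewrite exprn_ge0 ?subr_ge0.
  apply: ler_wpM2l; first by rewrite exprn_ge0.
  by rewrite ler_weXn2l ?lerDl // (card_peel_le hS).
rewrite [X in X <= _]big_mkcond [X in _ <= X]big_mkcond.
apply: ler_sum => K _; case: ifPn => [/and3P[KL Kk Dr]|_]; last first.
  by case: ifP => // _; rewrite !mulr_ge0 // exprn_ge0 ?subr_ge0.
(* Points of [K] are redundant over [K :|: M], so [K] and [D K] are disjoint. *)
rewrite KL sum_bern_cylinder; last first.
  rewrite -setI_eq0; apply/eqP/setP => x; rewrite !inE.
  apply/negP => /and3P[xK _ /asboolP[]]; congr S; apply/setUidPr.
  by rewrite sub1set !inE xK.
apply: ler_pM; rewrite ?exprn_ge0 ?subr_ge0 //; last first.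
  by rewrite ler_wiXn2l ?subr_ge0 // lerBlDr lerDl.
(* The left-over factor is [lambda ^+ (k - #|K|)], at least 1 because [#|K| <= k]. *)
rewrite expr_div_n mulrCA ler_peMr ?exprn_ge0 //.
by rewrite -(subnK Kk) exprD mulfK ?exprn_ege1 ?expf_neq0 ?gt_eqF.

Qed.

(** * Numerical estimates *)

Lemma expr_onem_le {R : realType} (q : R) (r : nat) :
  q <= 1 -> (1 - q) ^+ r <= expR (- (r%:R * q)).
Proof.
move=> q1; rewrite -mulrN expRM_natl.
by apply: lerXn2r; rewrite ?nnegrE ?subr_ge0 ?expR_ge0 // expR_ge1Dx.
Qed.

Lemma ln2_ge_half {R : realType} : 2^-1 <= ln (2 : R).
Proof.
have := @le_ln1Dx R (- 2^-1); rewrite (_ : 1 + - 2^-1 = 2^-1 :> R); last by lra.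
rewrite lnV ?posrE // => h; have : -1 < - 2^-1 :> R by lra.
by move/h; lra.
Qed.

Lemma natceil_bounds {R : realType} (x : R) :
  0 <= x -> x <= `|Num.ceil x|%N%:R < x + 1.
Proof.
move=> x0; have c0 : 0 <= Num.ceil x by rewrite ceil_ge0; lra.
have := ceil_itv x; rewrite natr_absz ger0_norm // intrD => /andP[h ->] /=.
by move: h; rewrite intrN; lra.
Qed.

Lemma nat_le_ceil {R : realType} (n : nat) (x : R) :
  n%:R <= x -> n%:Z <= Num.ceil x.
Proof.
by move=> nx; rewrite -(ler_int R); apply: le_trans nx (ceil_ge x).
Qed.

(** This lower bound lets the size estimates absorb the 1 lost in rounding up the number of
    layers. *)
Lemma ln_ratio_ge_half {R : realType} (k : nat) (delta : R) :
  (2 <= k)%N -> 0 < delta -> delta < 1 -> 2^-1 <= ln (k%:R / delta).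
Proof.
move=> k2 d0 d1; apply: le_trans ln2_ge_half _.
have k2' : 2 <= k%:R :> R by rewrite (ler_nat R 2).
rewrite ler_ln ?posrE // ?divr_gt0 // ?ler_pdivlMr //; nra.
Qed.

Lemma ln_ratio_ge0 {R : realType} (k : nat) (delta : R) :
  0 < delta -> delta < 1 -> 0 <= ln (k%:R / delta).
Proof.
(* For [k = 0] the logarithm of 0 is 0 by convention. *)
move=> d0 d1; case: k => [|k]; first by rewrite mul0r ln0.
apply: ln_ge0; rewrite ler_pdivlMr // mul1r (le_trans (ltW d1)) // ler1n //.
Qed.

Lemma monotone_decay_le {R : realType} (k r : nat) (q qmin delta : R) :
  0 < qmin -> 0 < delta -> qmin <= q -> q <= 1 ->
  ln (k%:R / delta) / qmin <= r%:R ->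
  k%:R * (1 - q) ^+ r <= delta.
Proof.
move=> qm0 d0 qmq q1 hr; case: k hr => [|k] hr; first by rewrite mul0r ltW.
have k0 : 0 < k.+1%:R :> R by rewrite ltr0n.
apply: (@le_trans _ _ (k.+1%:R * expR (- ln (k.+1%:R / delta)))); last first.
  by rewrite expRN lnK ?posrE ?divr_gt0 // invf_div mulrC divfK ?gt_eqF.
rewrite ler_pM2l //; apply: le_trans (expr_onem_le _ _ q1) _.
rewrite ler_expR lerN2; rewrite ler_pdivrMr // in hr.
by apply: le_trans hr _; rewrite ler_wpM2l.
Qed.

(** The three factors have exponents at most [2 k ln k], [r q / 2] and [- r q]. As
    [r q >= 4 k (ln k - ln delta)], the sum is at most [2 k ln delta <= ln delta]. *)
Lemma general_decay_le {R : realType} (k r : nat) (q qmin delta : R) :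
  (2 <= k)%N -> 0 < qmin -> 0 < delta -> delta < 1 -> qmin <= q -> q <= 1 ->
  4 * k%:R * ln (k%:R / delta) / qmin <= r%:R ->
  (2 * k%:R) ^+ k * (1 + q / (2 * k%:R)) ^+ (r * k) * (1 - q) ^+ r <= delta.
Proof.
move=> k2 qm0 d0 d1 qmq q1 hr.
have k2' : 2 <= k%:R :> R by rewrite (ler_nat R 2).
have k0 : 0 < k%:R :> R by lra.
have q0 : 0 < q by lra.
have e1 : (2 * k%:R) ^+ k <= expR (k%:R * (2 * ln (k%:R : R))).
  rewrite expRM_natl; apply: lerXn2r; rewrite ?nnegrE ?expR_ge0 //.
    by rewrite mulr_ge0 // ltW.
  (* Here [2 k <= k ^ 2], which uses [2 <= k]. *)
  by rewrite expRM_natl lnK ?posrE // expr2 ler_pM2r.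
have e2 : (1 + q / (2 * k%:R)) ^+ (r * k) <= expR (r%:R * q / 2).
  have -> : r%:R * q / 2 = (r * k)%:R * (q / (2 * k%:R)) :> R.
    by rewrite natrM; field; rewrite gt_eqF.
  rewrite expRM_natl; apply: lerXn2r; rewrite ?nnegrE ?expR_ge0 ?expR_ge1Dx //.
  by rewrite addr_ge0 // divr_ge0 //; lra.
have e3 := expr_onem_le q r q1.
have := ler_pM _ _ (ler_pM _ _ e1 e2) e3.
rewrite !mulr_ge0 ?exprn_ge0 ?subr_ge0 ?addr_ge0 ?divr_ge0 //; try lra.
move=> /(_ isT isT isT isT) h; apply: le_trans h _.
rewrite -!expRD -[leRHS]lnK ?posrE // ler_expR.
rewrite ln_div ?posrE // ler_pdivrMr // in hr.
have lnd : ln delta <= 0 by rewrite ln_le0 // ltW.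
have : r%:R * qmin <= r%:R * q by rewrite ler_wpM2l.
nra.
Qed.

Lemma monotone_size_le {R : realType} (k : nat) (qmin delta : R) :
  0 < qmin -> qmin <= 1 -> 0 < delta -> delta < 1 ->
  (`|Num.ceil (ln (k%:R / delta) / qmin)|%N * k)%N%:Z <=
  Num.ceil (5 * (k%:R * ln (k%:R / delta) / qmin)).
Proof.
move=> qm0 qm1 d0 d1.
have l0 := ln_ratio_ge0 k delta d0 d1.
set x := ln (k%:R / delta) / qmin.
have x0 : 0 <= x by rewrite divr_ge0 // ltW.
rewrite -mulrA -/x.
(* For [k = 1] the logarithm can be arbitrarily small, so the two ceilings are compared directly. *)
have [k1|k2] := leqP k 1.
  case: k k1 @x l0 x0 => [|[|//]] _ x l0 x0; first by rewrite muln0 mul0r mulr0 ceil0.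
  rewrite muln1 mul1r gez0_abs; last by rewrite ceil_ge0; lra.
  by apply: le_ceil; lra.
apply: nat_le_ceil; rewrite natrM mulrC mulrCA ler_wpM2l //.
have /andP[_ h] := natceil_bounds x x0.
have : 2^-1 <= x.
  rewrite ler_pdivlMr //; have := ln_ratio_ge_half k delta k2 d0 d1; lra.
lra.
Qed.

(** Since [k x >= 1], rounding [4 k x] up stays below [5 k x]: this is the constant 5. *)
Lemma general_size_le {R : realType} (k : nat) (qmin delta : R) :
  (2 <= k)%N -> 0 < qmin -> qmin <= 1 -> 0 < delta -> delta < 1 ->
  (`|Num.ceil (4 * k%:R * ln (k%:R / delta) / qmin)|%N * k)%N%:Z <=
  Num.ceil (5 * (k%:R ^+ 2 * ln (k%:R / delta) / qmin)).
Proof.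
move=> k2 qm0 qm1 d0 d1.
set x := ln (k%:R / delta) / qmin.
have k2' : 2 <= k%:R :> R by rewrite (ler_nat R 2).
have hx : 2^-1 <= x.
  rewrite ler_pdivlMr //; have := ln_ratio_ge_half k delta k2 d0 d1; lra.
rewrite -!mulrA -/x.
apply: nat_le_ceil; rewrite natrM mulrC [leRHS]mulrCA ler_wpM2l //.
have y0 : 0 <= 4 * (k%:R * x) by nra.
have /andP[_ h] := natceil_bounds _ y0.
nra.
Qed.

(** * Choice of the number of layers *)

Theorem mainTheorem4 (R : realType) :
  exists c : R, 0 < c /\
  forall (T : finType) (Sigma : Type) (S : {set T} -> Sigma)
         (k : nat) (qmin delta : R),
    composable S -> rank S = k ->
    0 < qmin -> 0 < delta -> delta < 1 ->
    (exists L : {set T},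
       #|L|%:Z <= Num.ceil (c * (k%:R ^+ 2 * ln (k%:R / delta) / qmin)) /\
       forall (q : R) (M : {set T}), qmin <= q -> q <= 1 ->
         1 - delta <=
           Pr_bern q (fun U : {set T} =>
             S ((U :&: L) :|: M) = S (U :|: M))) /\
    (monotone S ->
     exists L : {set T},
       #|L|%:Z <= Num.ceil (c * (k%:R * ln (k%:R / delta) / qmin)) /\
       forall (q : R) (M : {set T}), qmin <= q -> q <= 1 ->
         1 - delta <=
           Pr_bern q (fun U : {set T} =>
             S ((U :&: L) :|: M) = S (U :|: M))).
Proof.
exists 5; split=> // T Sigma S k qmin delta hS rk qm0 d0 d1.
(* If [qmin > 1] no [q] is admissible and the empty set will do. *)
have [qm1|qm1] := ltP 1 qmin.
  have l0 := ln_ratio_ge0 k delta d0 d1.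
  split=> [|_]; exists set0; (split=> [|q M qmq q1];
    last by have := lt_le_trans qm1 (le_trans qmq q1); rewrite ltxx);
    rewrite cards0; apply: nat_le_ceil;
    by rewrite mulr_ge0 // divr_ge0 ?mulr_ge0 ?exprn_ge0 // ltW.
have mono : monotone S ->
     exists L : {set T},
       #|L|%:Z <= Num.ceil (5 * (k%:R * ln (k%:R / delta) / qmin)) /\
       forall (q : R) (M : {set T}), qmin <= q -> q <= 1 ->
         1 - delta <=
           Pr_bern q (fun U : {set T} =>
             S ((U :&: L) :|: M) = S (U :|: M)).
  move=> hM; set x := ln (k%:R / delta) / qmin.
  have x0 : 0 <= x by rewrite divr_ge0 ?ln_ratio_ge0 // ltW.
  exists (peel S `|Num.ceil x|%N setT); split.
    apply: le_trans (monotone_size_le k qmin delta qm0 qm1 d0 d1).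
    by move: (card_peel_le hS `|Num.ceil x|%N setT); rewrite lez_nat rk.
  move=> q M qmq q1; have q0 := le_trans (ltW qm0) qmq.
  apply: Pr_sketch_ge => //.
  have [C mC CT] := exists_minimal_span S M setT setT (spans_refl _ _ _).
  have /minsetP[sC _] := mC.
  apply: le_trans (sum_misses_le hS hM q _ M setT C q0 q1 CT sC) _.
  have /andP[hx _] := natceil_bounds x x0.
  apply: le_trans (monotone_decay_le k _ q qmin delta qm0 d0 qmq q1 hx).
  apply: ler_wpM2r; first by rewrite exprn_ge0 ?subr_ge0.
  by rewrite ler_nat -rk (spans_card_le_rank hS _ _ _ mC).
split=> //.
(* For rank at most 1 the map is monotone and [k ^ 2 = k], so the monotone bound applies. *)
have [k1|k2] := leqP k 1.
  have -> : k%:R ^+ 2 = k%:R :> R.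
    by case: k k1 {rk mono} => [|[|//]] _; rewrite ?expr1n ?expr0n.
  by apply: mono; apply: (rank_le1_monotone hS); rewrite rk.
set x := 4 * k%:R * ln (k%:R / delta) / qmin.
have x0 : 0 <= x by rewrite divr_ge0 ?mulr_ge0 ?ln_ratio_ge0 // ltW.
exists (peel S `|Num.ceil x|%N setT); split.
  apply: le_trans (general_size_le k qmin delta k2 qm0 qm1 d0 d1).
  by move: (card_peel_le hS `|Num.ceil x|%N setT); rewrite lez_nat rk.
move=> q M qmq q1; have q0 := le_trans (ltW qm0) qmq.
apply: Pr_sketch_ge => //.
have /andP[hx _] := natceil_bounds x x0.
have lam1 : 1 <= 2 * k%:R :> R.
  by rewrite -natrM ler1n muln_gt0 (ltnW k2).
apply: le_trans (Pr_misses_le hS q (2 * k%:R) _ M setT q0 q1 lam1) _.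
by rewrite rk (general_decay_le k _ q qmin).
Qed.
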